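(* Let $\mathcal{D}$ be a domain in a (real or complex) Banach space $X$ and $\mathcal{A}$ a complex unital Banach algebra. Let $\mathcal{F}=\{F_t\}_{t\ge0}\subset C(\mathcal{D})$ be a semigroup on $\mathcal{D}$ generated by $f\in C(\mathcal{D},X)$. Assume that $\{\Gamma_t\}_{t\ge0}\subset C^1(\mathcal{D},\mathcal{A})$ is a semicocycle over $\mathcal{F}$ such that the family $\{\Gamma_t'[f]\}_{t\ge0}$, i.e. the family of maps $x\mapsto \Gamma_t'(x)[f(x)]$, is jointly continuous on $[0,\infty)\times\mathcal{D}$. Then for each $x\in\mathcal{D}$ the function $t\mapsto\Gamma_t(x)$ is differentiable on $[0,\infty)$. Moreover, defining $$B(x)=\left.\frac{d}{dt}\Gamma_t(x)\right|_{t=0},\qquad x\in\mathcal{D},$$ we have $B\in C(\mathcal{D},\mathcal{A})$, and for every $x\in\mathcal{D}$, $v(t,x)=\Gamma_t(x)$ is the unique solution of the evolution problem $$\frac{d v(t,x)}{dt}=B(F_t(x))\,v(t,x)\quad (t\ge0),\qquad v(0,x)=1_{\mathcal{A}}.$$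
   Context: A domain is a connected open set. $C(\mathcal{D},Y)$ (resp. $C^1(\mathcal{D},Y)$) is the set of continuous (resp. continuously Fréchet differentiable) maps $\mathcal{D}\to Y$, and $C(\mathcal{D})$ the set of continuous self-maps of $\mathcal{D}$. The unit satisfies $\|1_{\mathcal{A}}\|=1$. $\Gamma_t'(x)$ denotes the Fréchet derivative with respect to $x$. Derivatives in $t$ at $t=0$ are one-sided. Semigroup on $\mathcal{D}$: a family $\{F_t\}_{t\ge0}\subset C(\mathcal{D})$ with (i) $F_{t+s}=F_t\circ F_s$ for all $t,s\ge 0$; (ii) $\lim_{t\to0^+}F_t(x)=x$ for every $x\in\mathcal{D}$. It is generated by $f:\mathcal{D}\to X$ if $f(x)=\lim_{t\to0^+}\frac1t[F_t(x)-x]$ exists for every $x\in\mathcal{D}$; in this case $u(t,x)=F_t(x)$ solves $\partial_t u=f(u)$, $u(0,x)=x$. Semicocycle over $\{F_t\}$: a family of maps $\Gamma_t:\mathcal{D}\to\mathcal{A}$, $t\ge0$, with (a) $\Gamma_t(F_s(x))\Gamma_s(x)=\Gamma_{t+s}(x)$ for all $t,s\ge0$, $x\in\mathcal{D}$; (b) $\lim_{t\to0^+}\Gamma_t(x)=1_{\mathcal{A}}$ for every $x\in\mathcal{D}$. A family $\{f_t\}_{t\ge0}$ of maps from $\mathcal{D}$ to a Banach space is jointly continuous on $[0,\infty)\times\mathcal{D}$ if $\lim_{t\to t_0,\,x\to x_0}f_t(x)=f_{t_0}(x_0)$ for every $(t_0,x_0)\in[0,\infty)\times\mathcal{D}$.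 *)

(* Defs.v *)
From HB Require Import structures.
From mathcomp Require Import all_boot all_order all_algebra.
From mathcomp Require Import all_classical all_reals all_analysis.
From mathcomp Require Export complex.

Set Implicit Arguments.
Unset Strict Implicit.
Unset Printing Implicit Defensive.

Import Order.TTheory GRing.Theory Num.Theory.
Import numFieldNormedType.Exports.
Local Open Scope classical_set_scope.
Local Open Scope ring_scope.

(* A unital Banach algebra over K: a complete normed module with a product.
   An HB join of CompleteNormedModule and GRing.Algebra is not possible (HB
   would require Num.NumDomain to inherit from it), hence this record; its
   carrier gets both structures below. *)
Record banachAlgebra (K : numFieldType) := BanachAlgebra {
  banach_space : completeNormedModType K ;
  banach_mul : banach_space -> banach_space -> banach_space ;
  banach_one : banach_space ;
  banach_mulA : associative banach_mul ;
  banach_mul1l : left_id banach_one banach_mul ;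
  banach_mul1r : right_id banach_one banach_mul ;
  banach_mulDl : left_distributive banach_mul +%R ;
  banach_mulDr : right_distributive banach_mul +%R ;
  banach_scaleAl : forall (k : K) x y,
    k *: banach_mul x y = banach_mul (k *: x) y ;
  banach_scaleAr : forall (k : K) x y,
    k *: banach_mul x y = banach_mul x (k *: y) ;
  banach_normM : forall x y, `|banach_mul x y| <= `|x| * `|y| ;
  banach_norm1 : `|banach_one| = 1
}.

Definition banach_sort (K : numFieldType) (A : banachAlgebra K) : Type :=
  banach_space A.
Coercion banach_sort : banachAlgebra >-> Sortclass.

Section banach_algebra_instances.
Context (K : numFieldType) (A : banachAlgebra K).

HB.instance Definition _ := CompleteNormedModule.on (banach_sort A).

Let one_neq0 : banach_one A != 0.
Proof. by rewrite -normr_eq0 banach_norm1 oner_eq0. Qed.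

HB.instance Definition _ := GRing.Zmodule_isNzRing.Build (banach_sort A)
  (@banach_mulA K A) (@banach_mul1l K A) (@banach_mul1r K A)
  (@banach_mulDl K A) (@banach_mulDr K A) one_neq0.

HB.instance Definition _ :=
  GRing.Lmodule_isLalgebra.Build K (banach_sort A) (@banach_scaleAl K A).

HB.instance Definition _ :=
  GRing.Lalgebra_isAlgebra.Build K (banach_sort A) (@banach_scaleAr K A).

End banach_algebra_instances.

(* Restriction of scalars from R[i] to R. The norm of a normed module over
   R[i] takes its values in R[i] (it is a nonnegative real there), hence the
   real part in the norm of the realification. *)
Definition realification (R : realType) (V : lmodType R[i]) : Type := V.

Section realification_lmodule.
Context (R : realType) (V : lmodType R[i]).
Local Notation VR := (realification V).

HB.instance Definition _ := GRing.Zmodule.on VR.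

Definition realification_scale (r : R) (v : VR) : VR := r%:C%C *: (v : V).

Let scaleA a b (v : VR) :
  realification_scale a (realification_scale b v) =
  realification_scale (a * b) v.
Proof. by rewrite /realification_scale scalerA -rmorphM. Qed.

Let scale1 : left_id 1 realification_scale.
Proof. by move=> v; rewrite /realification_scale rmorph1 scale1r. Qed.

Let scaleDr : right_distributive realification_scale +%R.
Proof. by move=> a u v; rewrite /realification_scale scalerDr. Qed.

Let scaleDl v : {morph realification_scale^~ v : a b / a + b}.
Proof. by move=> a b; rewrite /realification_scale rmorphD scalerDl. Qed.

HB.instance Definition _ := GRing.Zmodule_isLmodule.Build R VR
  scaleA scale1 scaleDr scaleDl.

End realification_lmodule.

Section realification_normed.
Context (R : realType) (V : normedModType R[i]).
Local Notation VR := (realification V).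

Definition realification_norm (v : VR) : R := complex.Re `|v : V|.

Lemma realification_normE (v : VR) : (realification_norm v)%:C%C = `|v : V|.
Proof.
apply: RRe_real; exact: normr_real.
Qed.

Let normD (u v : VR) : realification_norm (u + v) <=
  realification_norm u + realification_norm v.
Proof.
by rewrite -lecR rmorphD /= !realification_normE ler_normD.
Qed.

Let normZ (r : R) (v : VR) :
  realification_norm (r *: v) = `|r| * realification_norm v.
Proof.
apply: complexI; rewrite rmorphM /= !realification_normE normrZ.
by rewrite normc_def /= expr0n addr0 sqrtr_sqr.
Qed.

Let norm0 (v : VR) : realification_norm v = 0 -> v = 0.
Proof.
move=> v0; apply/(@normr0_eq0 _ V).
by rewrite -realification_normE v0.
Qed.

HB.instance Definition _ := Lmodule_isNormed.Build R VR normD normZ norm0.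

End realification_normed.

Section realification_complete.
Context (R : realType) (V : completeNormedModType R[i]).
Local Notation VR := (realification V).

Lemma realification_ball (x : VR) (e : R) :
  ball x e = ball (x : V) (e%:C%C).
Proof.
rewrite -[LHS]/(ball_ (@realification_norm R V) x e) -ball_normE.
by apply/seteqP; split => y /=; rewrite -ltcR realification_normE.
Qed.

Let complete (F : set_system VR) : ProperFilter F -> cauchy F -> cvg F.
Proof.
move=> FF /cauchy_ballP Fc.
have : cvg ((F : set_system V) : set_system V).
  apply: cauchy_cvg; apply/cauchy_ballP => e e0.
  have eE : e = (complex.Re e)%:C%C by rewrite RRe_real// gtr0_real.
  have e0' : 0 < complex.Re e by rewrite -ltcR -eE.
  have := Fc _ e0'; apply: filterS => -[x y] /=.
  by rewrite realification_ball -eE.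
move=> /cvg_ex[l Fl]; apply/cvg_ex; exists (l : VR).
apply/cvg_ballP => e e0.
rewrite realification_ball.
by move/cvg_ballP : Fl; apply; rewrite ltcR.
Qed.

HB.instance Definition _ := Uniform_isComplete.Build VR complete.

End realification_complete.

Section realification_algebra.
Context (R : realType) (A : banachAlgebra R[i]).
Local Notation AR := (realification (banach_space A)).

Let scaleAl (r : R) (x y : AR) :
  r *: (banach_mul x y : AR) = banach_mul (r *: x : AR) y.
Proof. exact: banach_scaleAl. Qed.

Let scaleAr (r : R) (x y : AR) :
  r *: (banach_mul x y : AR) = banach_mul x (r *: y : AR).
Proof. exact: banach_scaleAr. Qed.

Let normM (x y : AR) : `|(banach_mul x y : AR)| <= `|x| * `|y|.
Proof.
by rewrite -lecR rmorphM /= !realification_normE banach_normM.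
Qed.

Let norm1 : `|(banach_one A : AR)| = 1.
Proof. by apply: complexI; rewrite realification_normE banach_norm1. Qed.

Definition realification_algebra : banachAlgebra R :=
  @BanachAlgebra R AR (@banach_mul _ A) (@banach_one _ A)
    (@banach_mulA _ A) (@banach_mul1l _ A) (@banach_mul1r _ A)
    (@banach_mulDl _ A) (@banach_mulDr _ A) scaleAl scaleAr normM norm1.

End realification_algebra.

(* A real or complex Banach space; all derivatives and limits below are taken
   in the underlying real Banach space. *)
Inductive banachSpace (R : realType) : Type :=
| RealBanach of completeNormedModType R
| ComplexBanach of completeNormedModType R[i].

Definition real_banach (R : realType) (X : banachSpace R) :
    completeNormedModType R :=
  match X with
  | RealBanach V => V
  | ComplexBanach V => realification V
  end.

Coercion real_banach : banachSpace >-> CompleteNormedModule.type.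

Section definitions.
Context {R : realType}.

(* Maps on D are represented by total maps, of which only the values on D
   matter; similarly families indexed by [0, +oo[ are indexed by R. *)
Definition domain (X : completeNormedModType R) (D : set X) : Prop :=
  open D /\ connected D.

Definition op_norm (X Y : normedModType R) (L : X -> Y) : R :=
  sup [set `|L h| | h in [set h : X | `|h| <= 1]].

Definition C1 (X Y : normedModType R) (D : set X) (g : X -> Y) : Prop :=
  (forall x, D x -> differentiable g x) /\
  (forall x0, D x0 ->
     op_norm (fun h => 'd g x h - 'd g x0 h) @[x --> x0] --> (0 : R)).

Definition self_map_family (X : completeNormedModType R) (D : set X)
    (F : R -> X -> X) : Prop :=
  forall t, 0 <= t -> (forall x, D x -> D (F t x)) /\
                      {within D, continuous (F t)}.

Definition semigroup_on (X : completeNormedModType R) (D : set X)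
    (F : R -> X -> X) : Prop :=
  [/\ self_map_family D F,
      forall t s x, 0 <= t -> 0 <= s -> D x -> F (t + s) x = F t (F s x)
    & forall x, D x -> F t x @[t --> 0^'+] --> x].

Definition generated_by (X : completeNormedModType R) (D : set X)
    (F : R -> X -> X) (f : X -> X) : Prop :=
  forall x, D x -> t^-1 *: (F t x - x) @[t --> 0^'+] --> f x.

Definition semicocycle (X : completeNormedModType R) (A : banachAlgebra R)
    (D : set X) (F : R -> X -> X) (G : R -> X -> A) : Prop :=
  (forall t s x, 0 <= t -> 0 <= s -> D x ->
     G t (F s x) * G s x = G (t + s) x) /\
  (forall x, D x -> G t x @[t --> 0^'+] --> (1 : A)).

Definition jointly_continuous (X Y : completeNormedModType R) (D : set X)
    (g : R -> X -> Y) : Prop :=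
  {within `[0, +oo[%classic `*` D, continuous (fun p : R * X => g p.1 p.2)}.

(* Differentiability on [0, +oo[: the difference quotient only involves
   points s >= 0, so that it is one-sided at t = 0 and two-sided at t > 0. *)
Definition diff_quotient (Y : normedModType R) (v : R -> Y) (t s : R) : Y :=
  (s - t)^-1 *: (v s - v t).

Definition derivable_ge0 (Y : normedModType R) (v : R -> Y) (t : R) : Prop :=
  cvg (diff_quotient v t s @[s --> within `[0, +oo[%classic t^']).

Definition derive_ge0 (Y : normedModType R) (v : R -> Y) (t : R) : Y :=
  lim (diff_quotient v t s @[s --> within `[0, +oo[%classic t^']).

Definition evolution_solution (A : banachAlgebra R) (b v : R -> A) : Prop :=
  (forall t, 0 <= t -> derivable_ge0 v t /\ derive_ge0 v t = b t * v t) /\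
  v 0 = 1.

End definitions.

(* Main.v *)
Require Import Defs.
From HB Require Import structures.
From mathcomp Require Import all_boot all_order all_algebra.
From mathcomp Require Import all_classical all_reals all_analysis.
From mathcomp Require Import ring lra.
Import Order.TTheory GRing.Theory Num.Theory.
Import numFieldNormedType.Exports.
Local Open Scope classical_set_scope.
Local Open Scope ring_scope.

(* Write [D_h = (Gamma_h x - 1) / h]. Summing
     Gamma_((k+1)h) x - Gamma_(kh) x - (Gamma_h x - 1)
       = (Gamma_(kh) (F_h x) - 1) (Gamma_h x - 1)
         + (Gamma_(kh) (F_h x) - Gamma_(kh) x)
   over [k < n] gives [|D_(nh) - D_h| <= e (|D_h| + 1)] for [nh] small, because
   [Gamma] is close to [1] near [(0, x0)] and, by the mean value inequality
   along the flow, [|Gamma_t (F_h x) - Gamma_t x| <= e h] (the derivative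
   [Gamma_t'[f]] is jointly continuous and vanishes at [t = 0]). Letting
   [nh] tend to [tau] while [h] tends to [0] shows that [D_h] is Cauchy, and
   that its limit [B] is locally a uniform limit of the continuous maps [D_tau].
   This avoids vector-valued integrals.
   Joint continuity of [Gamma] near [t = 0] and left continuity in time come
   from Baire's theorem and the semigroup identities. *)

Set Implicit Arguments.
Unset Strict Implicit.
Unset Printing Implicit Defensive.

(** * Mean value inequality and Gronwall's lemma *)

Lemma near_rightP (R : realType) (t : R) (P : R -> Prop) :
  (\forall s \near t^'+, P s) <->
  exists2 d, 0 < d & forall s, t < s < t + d -> P s.
Proof.
split=> [[d /= d0 hd]|[d d0 hd]].
  exists d => // s /andP[ts sd]; apply: hd => //=.
  by rewrite ltr_distlC; apply/andP; split; lra.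
exists d => //= s hs ts; move: hs; rewrite /= ltr_distlC => /andP[_ sd].
by apply: hd; rewrite ts.
Qed.

Lemma near_leftP (R : realType) (t : R) (P : R -> Prop) :
  (\forall s \near t^'-, P s) <->
  exists2 d, 0 < d & forall s, t - d < s < t -> P s.
Proof.
split=> [[d /= d0 hd]|[d d0 hd]].
  exists d => // s /andP[ts sd]; apply: hd => //=.
  by rewrite ltr_distlC; apply/andP; split; lra.
exists d => //= s hs ts; move: hs; rewrite /= ltr_distlC => /andP[sd _].
by apply: hd; rewrite ts sd.
Qed.

(** Let [c] be the supremum of the [t] such that [P] holds on the whole of [[a, t]]. The left
    hypothesis gives [P c], and if [c < b] the right one pushes past [c]. *)
Lemma real_induction (R : realType) (P : R -> Prop) (a b : R) :
  a <= b -> P a ->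
  (forall t, a <= t < b -> P t -> \forall s \near t^'+, P s) ->
  (forall t, a < t <= b -> (forall s, a <= s < t -> P s) -> P t) ->
  P b.
Proof.
move=> ab Pa Pr Pl.
pose S := [set t | a <= t <= b /\ forall s, a <= s <= t -> P s].
have Sa : S a.
  split; first by rewrite lexx ab.
  by move=> s; rewrite -eq_le => /eqP <-.
have Sub : ubound S b by move=> t [/andP[]].
have Ssup : has_sup S by split; [exists a | exists b].
pose c := sup S.
have ac : a <= c by apply: ub_le_sup => //; exists b.
have cb : c <= b by apply: ge_sup => //; exists a.
have below s : a <= s < c -> P s.
  move=> /andP[as_ sc]; have [t [_ Pt] st] := sup_gt (ex_intro _ a Sa) sc.
  by apply: Pt; rewrite as_ ltW.
have Pc : P c.
  move: ac; rewrite le_eqVlt => /predU1P[<-//|ac].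
  by apply: Pl; rewrite ?ac.
have [<-//|ncb] := eqVneq c b.
have cb' : c < b by rewrite lt_neqAle ncb.
have := Pr c; rewrite ac cb' => /(_ isT Pc).
move=> /near_rightP[e e0 he].
pose d := Num.min (c + e / 2) b.
have cd : c < d by rewrite lt_min cb' andbT ltrDl divr_gt0.
suff : S d by move=> /(ub_le_sup (ex_intro _ b Sub)); rewrite leNgt cd.
split; first by rewrite ge_min lexx orbT (le_trans ac (ltW cd)).
move=> s /andP[as_]; rewrite le_min => /andP[se sb].
have [sc|cs] := ltP s c; first by apply: below; rewrite as_.
move: cs; rewrite le_eqVlt => /predU1P[<-//|cs].
by apply: he; rewrite cs; lra.
Qed.

(** Real induction on the bound itself. The local estimate may assume the bound already reached at
    [t]; this allows bootstrap arguments in which the estimate holds only while [u] stays close to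
    [u a]. *)
Lemma norm_increment_le (R : realType) (Y : normedModType R) (u : R -> Y)
    (a b M : R) :
  a <= b -> 0 <= M ->
  (forall t, a < t <= b -> u s @[s --> t^'-] --> u t) ->
  (forall t, a <= t < b -> `|u t - u a| <= M * (t - a) ->
     \forall s \near t^'+, `|u s - u t| <= M * (s - t)) ->
  `|u b - u a| <= M * (b - a).
Proof.
move=> ab M0 ul ur.
apply: (real_induction (P := fun t => `|u t - u a| <= M * (t - a)) ab) => //.
- by rewrite !subrr normr0 mulr0.
- move=> t tab Pt; have := ur _ tab Pt; apply: filterS => s us.
  apply: le_trans (ler_distD (u t) _ _) _.
  by apply: le_trans (lerD us Pt) _; rewrite -mulrDr ler_wpM2l//; lra.
- move=> t /andP[at_ tb] Pt; apply/ler_addgt0Pr => e e0.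
  have /ul/cvgrPdist_le/(_ _ e0) : a < t <= b by rewrite at_.
  move=> /near_leftP[d d0 hd].
  pose s := Num.max a (t - d / 2).
  have st : s < t by rewrite gt_max at_/=; lra.
  have as_ : a <= s by rewrite le_max lexx.
  have ds : t - d < s by rewrite lt_max; apply/orP; right; lra.
  apply: le_trans (ler_distD (u s) _ _) _.
  have := hd s; rewrite ds st => /(_ isT) h1.
  have := Pt s; rewrite as_ st => /(_ isT) h2.
  have h3 : M * (s - a) <= M * (t - a) by rewrite ler_wpM2l//; lra.
  lra.
Qed.

Definition right_derivative (R : realType) (Y : normedModType R) (u : R -> Y)
    (t : R) (l : Y) : Prop :=
  forall e, 0 < e ->
    \forall s \near t^'+, `|u s - u t - (s - t) *: l| <= e * (s - t).

(** Subtracting the affine part [s *: l0] leaves a function whose right derivative has norm at most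
    [M], so its increments grow at rate at most [M + d] for every [d > 0]. *)
Lemma mean_value_le (R : realType) (Y : normedModType R) (u l : R -> Y)
    (a b M : R) (l0 : Y) :
  a <= b -> 0 <= M ->
  (forall t, a < t <= b -> u s @[s --> t^'-] --> u t) ->
  (forall t, a <= t < b -> right_derivative u t (l t) /\ `|l t - l0| <= M) ->
  `|u b - u a - (b - a) *: l0| <= M * (b - a).
Proof.
move=> ab M0 ul ur; apply/ler_addgt0Pr => e e0.
(* The total slack [d * (b - a)] must stay below [e]; the [+ 1] covers the case [a = b]. *)
have d0 : 0 < e / (b - a + 1) by rewrite divr_gt0//; lra.
set d := e / _ in d0.
pose w s := u s - s *: l0.
have wE s t : w s - w t = u s - u t - (s - t) *: l0.
  by rewrite /w scalerBl opprD opprK addrACA [in RHS]opprB [- _ + _]addrC.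
rewrite -wE; have : `|w b - w a| <= (M + d) * (b - a).
  apply: norm_increment_le => //; first by lra.
    move=> t /ul ut; apply: cvgB => //.
    by apply: cvgZr_tmp; apply: cvg_at_left_filter; exact: cvg_id.
  move=> t /ur[utl lM] _; have := utl _ d0.
  move=> /near_rightP[r r0 hr]; apply/near_rightP; exists r => // s sr.
  have -> : w s - w t = (s - t) *: (l t - l0) + (u s - u t - (s - t) *: l t).
    by rewrite wE scalerBr [RHS]addrC addrA subrK.
  rewrite mulrDl.
  apply: le_trans (ler_normD _ _) _; apply: lerD; last exact: hr.
  have st0 : 0 < s - t by lra.
  by rewrite normrZ gtr0_norm// mulrC ler_wpM2r// ltW.
move=> /le_trans; apply; rewrite mulrDl lerD2l /d mulrAC ler_pdivrMr; last lra.
by rewrite ler_wpM2l//; lra.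
Qed.

(** The norm of [w] cannot overtake an exponential barrier [E] with [E b = e], and [e] is arbitrary.
    The rate [M + 1] of the barrier exceeds [M], and the surplus absorbs the error term of the right
    derivative. *)
Lemma gronwall_eq0 (R : realType) (Y : normedModType R) (w l : R -> Y)
    (a b M : R) :
  a <= b -> 0 <= M -> w a = 0 ->
  (forall t, a < t <= b -> w s @[s --> t^'-] --> w t) ->
  (forall t, a <= t < b ->
     right_derivative w t (l t) /\ `|l t| <= M * `|w t|) ->
  w b = 0.
Proof.
move=> ab M0 wa wl wr; apply/eqP; rewrite -normr_le0.
apply/ler_addgt0Pr => e e0; rewrite add0r; pose K := M + 1.
pose E t := e * expR (K * (t - a)) / expR (K * (b - a)).
have -> : e = E b by rewrite /E mulfK// gt_eqF// expR_gt0.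
have E0 t : 0 < E t by rewrite divr_gt0 ?mulr_gt0 ?expR_gt0.
have EK t s : t <= s -> E t * (1 + K * (s - t)) <= E s.
  move=> ts; have -> : E s = E t * expR (K * (s - t)).
    rewrite /E [RHS]mulrAC -[in RHS](mulrA e) -expRD -mulrDr.
    by have -> : t - a + (s - t) = s - a by lra.
  by rewrite ler_wpM2l ?expR_ge1Dx// ltW.
apply: (real_induction (P := fun t => `|w t| <= E t) ab).
- by rewrite wa normr0 ltW.
- move=> t /wr[wtl lM] Pt; have := wtl _ (E0 t).
  move=> /near_rightP[r r0 hr]; apply/near_rightP; exists r => // s sr.
  have {}hr := hr _ sr; have st0 : 0 < s - t by lra.
  apply: le_trans (EK t s _); last lra.
  have -> : w s = w t + ((s - t) *: l t + (w s - w t - (s - t) *: l t)).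
    by rewrite [_ *: _ + _]addrC subrK addrC subrK.
  apply: le_trans (ler_normD _ _) _.
  have h2 : `|(s - t) *: l t| <= (s - t) * (M * E t).
    rewrite normrZ gtr0_norm// ler_wpM2l//; first lra.
    by apply: le_trans lM _; rewrite ler_wpM2l.
  have h3 := ler_normD ((s - t) *: l t) (w s - w t - (s - t) *: l t).
  rewrite /K; lra.
- move=> t /andP[at_ tb] Pt; apply/ler_addgt0Pr => d d0.
  have /wl/cvgrPdist_le/(_ _ d0) : a < t <= b by rewrite at_.
  move=> /near_leftP[r r0 hr].
  pose s := Num.max a (t - r / 2).
  have st : s < t by rewrite gt_max at_/=; lra.
  have as_ : a <= s by rewrite le_max lexx.
  have ds : t - r < s by rewrite lt_max; apply/orP; right; lra.
  have := hr s; rewrite ds st => /(_ isT) h1.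
  have := Pt s; rewrite as_ st => /(_ isT) h2.
  have h3 : E s <= E t.
    apply: le_trans (EK s t _); last lra.
    have h4 : 0 <= K * (t - s) by rewrite mulr_ge0//; rewrite /K; lra.
    by rewrite ler_peMr ?(ltW (E0 s))//; lra.
  have := ler_normD (w t - w s) (w s); rewrite subrK; lra.
Qed.

(** * Joint continuity from separate continuity *)

(** Baire's theorem on the line: for each [n], the union of the open intervals satisfying [P n] is
    dense in []a, b[], so some point lies in all these unions. *)
Lemma nested_intervals (R : realType) (a b : R) (P : nat -> R -> R -> Prop) :
  a < b ->
  (forall n c d, a <= c < d -> d <= b ->
     exists c' d', [/\ c <= c', c' < d', d' <= d & P n c' d']) ->
  exists2 s, a < s < b & forall n, exists c d, c < s < d /\ P n c d.
Proof.
move=> ab hP.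
(* The two outer half-lines make [U n] dense in the whole line; they do not meet []a, b[], where [s]
   is finally taken. *)
pose U n := [set s | s < a] `|` [set s | b < s] `|`
  \bigcup_(p in [set p | P n p.1 p.2]) [set s | p.1 < s < p.2].
have Uod n : open (U n) /\ dense (U n).
  split.
    apply: openU; first by apply: openU; [exact: open_lt | exact: open_gt].
    apply: bigcup_open => -[c d] _ /=.
    have -> : [set s | c < s < d] = `]c, d[%classic.
      by apply/seteqP; split => s /=; rewrite in_itv.
    exact: interval_open.
  move=> O [p Op] /(_ p Op)/nbhs_ballP[e /= e0 eO].
  have [pa|ap] := ltP p a; first by exists p; split => //; left; left.
  have [bp|pb] := ltP b p; first by exists p; split => //; left; right.
  pose c := Num.max a (p - e / 2); pose d := Num.min b (p + e / 2).
  have cd : c < d.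
    rewrite /c /d lt_min !gt_max ab /=; apply/andP; split; first lra.
    by apply/andP; split; lra.
  have [||c' [d' [cc' cd' dd' Pn]]] := hP n c d.
  - by rewrite cd le_max lexx.
  - by rewrite ge_min lexx.
  have h1 : p - e / 2 <= c by rewrite le_max lexx orbT.
  have h2 : d <= p + e / 2 by rewrite ge_min lexx orbT.
  exists ((c' + d') / 2); split.
    by apply: eO; rewrite /ball/= ltr_distlC; apply/andP; split; lra.
  by right; exists (c', d') => //=; apply/andP; split; lra.
have := Baire Uod; move=> /(_ `]a, b[%classic).
case.
- by exists ((a + b) / 2); rewrite /= in_itv/=; apply/andP; split; lra.
- exact: interval_open.
move=> s [/=]; rewrite in_itv/= => sab Us; exists s => // n.
have [[/=|/=]|[[c d] /= Pn cd]] := Us n I; [lra | lra|].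
by exists c, d.
Qed.

(** Two category arguments. The first ([step1]) finds subintervals on which [g t x] is close to
    [g t x0] uniformly in [t]; the second adds right continuity of [g] at [x0] to make the joint
    oscillation small on intervals nested around one [s]. *)
Lemma joint_continuity_point (R : realType) (X Y : normedModType R)
    (g : R -> X -> Y) (x0 : X) (r a b : R) :
  0 < r -> a < b ->
  (forall x t, `|x - x0| < r -> a <= t <= b -> g s x @[s --> t^'+] --> g t x) ->
  (forall t, a <= t <= b -> g t x @[x --> x0] --> g t x0) ->
  exists2 s, a < s < b &
    forall e, 0 < e -> exists2 d, 0 < d &
      forall t x, `|t - s| < d -> `|x - x0| < d -> `|g t x - g s x0| <= e.
Proof.
move=> r0 ab gt gx.
have step1 e c d : 0 < e -> a <= c < d -> d <= b -> exists c' d' k,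
    [/\ c <= c', c' < d', d' <= d, 0 < k & forall t x, c' < t < d' ->
       `|x - x0| < k -> `|g t x - g t x0| <= e].
  move=> e0 /andP[ac cd] db; apply: contrapT => no.
  (* If [step1] fails, every subinterval contains a violation with [x] arbitrarily close to [x0].
     Some [s] then sees violations for all [n], against continuity of [g s] at [x0]. *)
  pose P (n : nat) c d := forall t, c < t < d ->
    exists2 x, `|x - x0| < Num.min r n.+1%:R^-1 & e < `|g t x - g t x0|.
  have rn n : 0 < Num.min r n.+1%:R^-1 by rewrite lt_min r0 invr_gt0 ltr0Sn.
  have [||s scd sP] := @nested_intervals R c d P; first exact: cd.
    move=> n c1 d1 /andP[cc1 cd1] dd1.
    have : exists2 t, c1 < t < d1 &
        exists2 x, `|x - x0| < Num.min r n.+1%:R^-1 & e < `|g t x - g t x0|.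
      apply: contrapT => h; apply: no.
      exists c1, d1, (Num.min r n.+1%:R^-1); split => // t x tcd xn.
      by rewrite leNgt; apply/negP => h2; apply: h; exists t => //; exists x.
    move=> [t /andP[ct td] [x xn ex]].
    have tab : a <= t <= b by apply/andP; split; lra.
    have xr : `|x - x0| < r by move: xn; rewrite lt_min => /andP[].
    have x0r : `|x0 - x0| < r by rewrite subrr normr0.
    (* With [x] fixed, the strict violation at [t] persists on an interval to the right of [t]. *)
    have : `|g s x - g s x0| @[s --> t^'+] --> `|g t x - g t x0|.
      by apply: cvg_norm; apply: cvgB; exact: gt.
    move=> /cvgrPdist_lt/(_ (`|g t x - g t x0| - e)).
    rewrite subr_gt0 => /(_ ex)/near_rightP[h h0 hh].
    exists t, (Num.min d1 (t + h)); split; rewrite ?ge_min ?lexx//; first lra.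
      by rewrite lt_min td; lra.
    move=> s; rewrite lt_min => /andP[ts /andP[sd1 sth]]; exists x => //.
    have := hh s; rewrite ts sth => /(_ isT).
    rewrite /= ltr_distlC => /andP[h1 _]; lra.
  have sab : a <= s <= b by apply/andP; split; lra.
  have /cvgrPdist_le/(_ _ e0)/nbhs_ballP[k /= k0 hk] := gx s sab.
  have [n nk] : exists n, (n.+1%:R^-1 : R) < k.
    exists (Num.truncn k^-1); rewrite invf_plt ?posrE ?ltr0Sn//.
    exact: truncnS_gt.
  have [c1 [d1 [cs /(_ _ cs)[x xn]]]] := sP n.
  rewrite ltNge distrC => /negP; apply; apply: hk.
  rewrite -ball_normE /= distrC; move: xn; rewrite lt_min => /andP[_ xn].
  exact: lt_trans xn nk.
pose P (n : nat) c d := exists2 k, 0 < k & forall t t' x, c < t < d ->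
  c < t' < d -> `|x - x0| < k -> `|g t x - g t' x0| <= n.+1%:R^-1.
have [||s sab sP] := @nested_intervals R a b P; first exact: ab.
  move=> n c d acd db.
  pose e : R := n.+1%:R^-1.
  have e0 : 0 < e by rewrite invr_gt0 ltr0Sn.
  have e30 : 0 < e / 3 by lra.
  have [c1 [d1 [k [cc1 cd1 dd1 k0 hk]]]] := step1 _ _ _ e30 acd db.
  (* The three thirds of [e] pay for the path from [g t x] to [g t x0], then [g m x0], then
     [g t' x0]. Right continuity at [m] only controls times after [m], so the new interval starts
     there. *)
  pose m := (c1 + d1) / 2.
  have mab : a <= m <= b by apply/andP; split; rewrite /m; lra.
  have x0r : `|x0 - x0| < r by rewrite subrr normr0.
  have /cvgrPdist_le/(_ _ e30)/near_rightP[h h0 hh] := gt x0 m x0r mab.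
  exists m, (Num.min d1 (m + h)); split; rewrite ?ge_min ?dd1 ?lt_min ?/m//.
  - lra.
  - by apply/andP; split; lra.
  exists k => // t t' x; rewrite !lt_min -/m => /andP[mt /andP[td th]].
  move=> /andP[mt' /andP[td' th']] xk.
  have h1 : `|g t x - g t x0| <= e / 3.
    by apply: hk => //; rewrite /m in mt; lra.
  have := hh t; rewrite mt th => /(_ isT) h2.
  have := hh t'; rewrite mt' th' => /(_ isT) h3.
  have := ler_distD (g t x0) (g t x) (g t' x0).
  have := ler_distD (g m x0) (g t x0) (g t' x0).
  rewrite [`|g t x0 - g m x0|]distrC -/e; lra.
exists s => // e e0.
have [n ne] : exists n, (n.+1%:R^-1 : R) < e.
  exists (Num.truncn e^-1); rewrite invf_plt ?posrE ?ltr0Sn//.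
  exact: truncnS_gt.
have [c [d [scd [k k0 hk]]]] := sP n.
exists (Num.min k (Num.min (s - c) (d - s))).
  by rewrite !lt_min k0 !subr_gt0; lra.
move=> t x; rewrite !lt_min => /andP[_ /andP[tc td]] /andP[xk _].
apply: le_trans (ltW ne); apply: hk => //.
move: tc td; rewrite !ltr_distl => /andP[? _] /andP[_ ?].
by apply/andP; split; lra.
Qed.

(** * One-sided limits and derivatives *)

Lemma cvg_rightP (R : realType) (Y : normedModType R) (u : R -> Y) (t : R)
    (l : Y) :
  u s @[s --> t^'+] --> l <->
  forall e, 0 < e -> exists2 d, 0 < d &
    forall h, 0 < h < d -> `|u (t + h) - l| <= e.
Proof.
split=> [/cvgrPdist_le ul e e0|ul].
  have /near_rightP[d d0 hd] := ul _ e0; exists d => // h /andP[h0 hd'].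
  by rewrite distrC; apply: hd; lra.
apply/cvgrPdist_le => e /ul[d d0 hd]; apply/near_rightP; exists d => // s sd.
by have := hd (s - t); rewrite [t + _]addrC subrK distrC; apply; lra.
Qed.

Lemma cvg_realP (R : realType) (Y : normedModType R) (u : R -> Y) (t : R)
    (l : Y) :
  u s @[s --> t] --> l <->
  forall e, 0 < e -> exists2 d, 0 < d &
    forall s, `|s - t| < d -> `|u s - l| <= e.
Proof.
split=> [/cvgrPdist_le ul e e0|ul].
  have /nbhs_ballP[d /= d0 hd] := ul _ e0; exists d => // s sd.
  by rewrite distrC; apply: hd; rewrite /ball/= distrC.
apply/cvgrPdist_le => e /ul[d d0 hd]; apply/nbhs_ballP; exists d => //= s.
by rewrite /ball/= distrC => /hd; rewrite distrC.
Qed.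

Lemma right_derivativeP (R : realType) (Y : normedModType R) (u : R -> Y)
    (t : R) (l : Y) :
  h^-1 *: (u (t + h) - u t) @[h --> 0^'+] --> l <-> right_derivative u t l.
Proof.
have H h : 0 < h ->
    u (t + h) - u t - h *: l = h *: (h^-1 *: (u (t + h) - u t) - l).
  by move=> h0; rewrite scalerBr scalerA divff ?gt_eqF// scale1r.
split=> [/cvg_rightP ul e /ul[d d0 hd]|ul].
  apply/near_rightP; exists d => // s sd; have st0 : 0 < s - t by lra.
  have := H _ st0; rewrite [t + _]addrC subrK => ->.
  rewrite normrZ gtr0_norm// mulrC ler_wpM2r// ?(ltW st0)//.
  by have := hd (s - t); rewrite add0r [t + _]addrC subrK; apply; lra.
apply/cvg_rightP => e /ul/near_rightP[d d0 hd]; exists d => // h hd'.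
have h0 : 0 < h by lra.
have /hd : t < t + h < t + d by lra.
have -> : t + h - t = h by lra.
rewrite H//.
by rewrite normrZ gtr0_norm// add0r mulrC ler_pM2r.
Qed.

Lemma right_derivative_cst (R : realType) (Y : normedModType R) (u : R -> Y)
    (t : R) (l : Y) :
  (forall s, t <= s -> u s = u t) ->
  right_derivative u t l -> l = 0.
Proof.
move=> ut ul; apply/eqP; rewrite -normr_le0; apply/ler_addgt0Pr => e e0.
have /near_rightP[d d0 hd] := ul _ e0.
have /hd : t < t + d / 2 < t + d by lra.
rewrite ut; last lra.
rewrite subrr sub0r normrN addrC addKr normrZ gtr0_norm; last lra.
by rewrite mulrC ler_pM2r ?add0r//; lra.
Qed.

(** The one-sided chain rule: [e1] bounds the remainder of [g], and [e2] that of [u] after applying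
    the differential of norm at most [K]. Taking [e2 <= 1] also makes the increment of [u] at most
    [(s - t) * (|l| + 1)]. *)
Lemma right_derivative_comp (R : realType) (X Y : normedModType R)
    (g : X -> Y) (u : R -> X) (t : R) (l : X) :
  differentiable g (u t) -> right_derivative u t l ->
  right_derivative (g \o u) t ('d g (u t) l).
Proof.
move=> dg ul e e0.
have [K K0 hK] : exists2 K, 0 < K & forall h, `|'d g (u t) h| <= K * `|h|.
  have /linear_bounded_continuous/linear_boundedP := diff_continuous dg.
  by move=> /pinfty_ex_gt0[K K0 hK]; exists K.
have l0 := normr_ge0 l.
pose e1 := e / (2 * (`|l| + 1)).
have e10 : 0 < e1 by rewrite divr_gt0//; lra.
pose e2 := Num.min 1 (e / (2 * K)).
have e20 : 0 < e2 by rewrite lt_min ltr01 divr_gt0//; lra.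
have : \forall h \near (0 : X),
    `|g (h + u t) - g (u t) - 'd g (u t) h| <= e1 * `|h|.
  have /eqaddoP/(_ _ e10) := diff_locally dg; apply: filterS => h.
  by rewrite !fctE /= opprD addrA.
move=> /nbhs_ballP[r /= r0 hr].

have lp : 0 < `|l| + 1 by lra.
have /near_rightP[d d0 hd] := ul _ e20.
apply/near_rightP; exists (Num.min d (r / (`|l| + 1))).
  by rewrite lt_min d0 divr_gt0.
move=> s /andP[ts]; rewrite -ltrBlDl lt_min => /andP[sd sr] /=.
have st0 : 0 < s - t by lra.
have {}hd : `|u s - u t - (s - t) *: l| <= e2 * (s - t) by apply: hd; lra.
have nl : `|(s - t) *: l| = (s - t) * `|l| by rewrite normrZ gtr0_norm.
have h1 : e2 * (s - t) <= s - t by rewrite ler_piMl ?ge_min ?lexx// ltW.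
have k1 : `|u s - u t| <= (s - t) * (`|l| + 1).
  have := ler_normD (u s - u t - (s - t) *: l) ((s - t) *: l).
  rewrite subrK; lra.
have /hr : ball (0 : X) r (u s - u t).
  rewrite -ball_normE /= sub0r normrN (le_lt_trans k1)//.
  by rewrite -ltr_pdivlMr.
rewrite subrK => h2.
have h3 : `|'d g (u t) (u s - u t) - (s - t) *: 'd g (u t) l| <=
    e / 2 * (s - t).
  rewrite -linearZ -linearB (le_trans (hK _))//.
  apply: (@le_trans _ _ (K * (e2 * (s - t)))); first by rewrite ler_pM2l.
  have -> : e / 2 = K * (e / (2 * K)) by field; rewrite gt_eqF.
  by rewrite mulrA ler_wpM2r ?(ltW st0)// ler_pM2l// ge_min lexx orbT.
have h4 : e1 * `|u s - u t| <= e / 2 * (s - t).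
  have -> : e / 2 * (s - t) = e1 * ((s - t) * (`|l| + 1)).
    by rewrite /e1; field; rewrite gt_eqF.
  by rewrite ler_pM2l.
apply: le_trans (ler_distD ('d g (u t) (u s - u t)) _ _) _.
lra.
Qed.

(** The special case of a [g] constant in [x]. One two-sided continuity point suffices later, since
    the semigroup identities carry it to all larger times. *)
Lemma continuity_point (R : realType) (Y : normedModType R) (u : R -> Y)
    (a b : R) :
  a < b ->
  (forall t, a <= t <= b -> u s @[s --> t^'+] --> u t) ->
  exists2 s, a < s < b & u t @[t --> s] --> u s.
Proof.
move=> ab ur.
have [x t _|x t|s sab h] :=
  @joint_continuity_point R R Y (fun t _ => u t) 0 1 a b ltr01 ab.
- exact: ur.
- exact: cvg_cst.
exists s => //; apply/cvg_realP => e /h[d d0 hd]; exists d => // t td.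
by apply: (hd t 0) => //; rewrite subrr normr0.
Qed.

Lemma cvg_banach_mul (R : realType) (A : banachAlgebra R) (T : Type)
    (F : set_system T) (FF : Filter F) (u v : T -> A) (a b : A) :
  u x @[x --> F] --> a -> v x @[x --> F] --> b ->
  u x * v x @[x --> F] --> a * b.
Proof.
move=> /cvgrPdist_le ua /cvgrPdist_le vb; apply/cvgrPdist_le => e e0.
have a0 := normr_ge0 a; have b0 := normr_ge0 b.
pose M := 1 + `|a| + `|b|.
have M0 : 0 < M by rewrite /M; lra.
pose d := Num.min 1 (e / M).
have d0 : 0 < d by rewrite lt_min ltr01 divr_gt0.
have d1 : d <= 1 by rewrite ge_min lexx.
have dM : d * M <= e by rewrite -ler_pdivlMr// ge_min lexx orbT.
apply: filterS (filterI (ua _ d0) (vb _ d0)) => x [ux vx].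
have -> : a * b - u x * v x = (a - u x) * b + u x * (b - v x).
  by rewrite mulrBl mulrBr addrA subrK.
have nM := @banach_normM _ A.
have h1 : `|(a - u x) * b| <= d * `|b|.
  by apply: le_trans (nM _ _) _; rewrite ler_wpM2r.
have h2 : `|u x * (b - v x)| <= (1 + `|a|) * d.
  apply: le_trans (nM _ _) _; apply: ler_pM => //.
  have := ler_normD (u x - a) a; rewrite subrK [`|u x - a|]distrC; lra.
have := ler_normD ((a - u x) * b) (u x * (b - v x)).
rewrite /M in dM; lra.
Qed.

(** * Semigroups *)

Section semigroup.
Context (R : realType) (X : completeNormedModType R) (D : set X).
Context (F : R -> X -> X) (f : X -> X).
Hypotheses (Dopen : open D) (sgF : semigroup_on D F).

Lemma semigroup_in t x : 0 <= t -> D x -> D (F t x).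
Proof. by case: sgF => FD _ _ t0 Dx; have [+ _] := FD _ t0; apply. Qed.

Lemma semigroup_add t s x : 0 <= t -> 0 <= s -> D x ->
  F (t + s) x = F t (F s x).
Proof. by case: sgF => _ FF _; exact: FF. Qed.

Lemma semigroup_cvg t x : 0 <= t -> D x -> F t y @[y --> x] --> F t x.
Proof.
case: sgF => FD _ _ t0 Dx; have [_] := FD _ t0.
by rewrite continuous_open_subspace// => /(_ x); rewrite in_setE => /(_ Dx).
Qed.

(** As [t] tends to [0], [F t (F 0 x) = F t x] tends both to [F 0 x] and to [x]. *)
Lemma semigroup0 x : D x -> F 0 x = x.
Proof.
case: sgF => _ FF F0 Dx.
have D0 : D (F 0 x) by exact: semigroup_in.
apply: (@norm_cvg_unique _ _ (F t x @[t --> 0^'+])); last exact: F0.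
have := F0 _ D0; apply: cvg_trans; apply: near_eq_cvg.
near=> t; have t0 : 0 <= t by near: t; exact: nbhs_right_ge.
by rewrite -FF// addr0.
Unshelve. all: by end_near. Qed.

Lemma semigroup_cvg_right t x : 0 <= t -> D x ->
  F s x @[s --> t^'+] --> F t x.
Proof.
case: sgF => _ FF F0 t0 Dx.
have /cvg_rightP h := F0 _ (semigroup_in t0 Dx).
apply/cvg_rightP => e /h[d d0 hd]; exists d => // s sd.
by have := hd s sd; rewrite add0r [t + s]addrC FF//; lra.
Qed.

Lemma semigroup_right_derivative t x : generated_by D F f -> 0 <= t -> D x ->
  right_derivative (F^~ x) t (f (F t x)).
Proof.
move=> gen t0 Dx; apply/right_derivativeP.
have := gen _ (semigroup_in t0 Dx); apply: cvg_trans; apply: near_eq_cvg.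
near=> h; have h0 : 0 <= h by near: h; exact: nbhs_right_ge.
by rewrite -semigroup_add// [h + t]addrC.
Unshelve. all: by end_near. Qed.

(** The orbit is continuous at some [s] between [0] and [t]; composing with the continuous map
    [F (t - s)] moves this to time [t]. *)
Lemma semigroup_continuous_time (t : R) x : 0 < t -> D x ->
  F s x @[s --> t] --> F t x.
Proof.
move=> t0 Dx.
have [s|s /andP[s0 st] us] := continuity_point (u := F^~ x) t0.
  by move=> /andP[s0 _]; exact: semigroup_cvg_right.
have ts0 : 0 <= t - s by lra.
have : F (t - s) (F s' x) @[s' --> s] --> F (t - s) (F s x).
  apply: cvg_comp us _; apply: semigroup_cvg => //.
  by apply: semigroup_in => //; lra.
move=> /cvg_realP h; apply/cvg_realP => e /h[d d0 hd].
(* The bound by [s] keeps the shifted time [t' - (t - s)] nonnegative, so that the semigroup law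
   applies. *)
exists (Num.min d s); first by rewrite lt_min d0.
move=> t'; rewrite lt_min => /andP[td ts].
have {ts} : - s < t' - t by move: ts; rewrite ltr_norml => /andP[].
move=> ts; have := hd (t' - (t - s)).
rewrite -!semigroup_add//; [|lra|lra].
have -> : t - s + (t' - (t - s)) = t' by lra.
rewrite subrK; apply.
by have -> : t' - (t - s) - s = t' - t by lra.
Qed.

(** Near [x0] the speed [f] is bounded, so an orbit needs a definite time to leave a ball. The
    induction hypothesis of [norm_increment_le] keeps the orbit in the ball where this bound is
    known. *)
Lemma semigroup_near0 x0 e : {within D, continuous f} -> generated_by D F f ->
  D x0 -> 0 < e ->
  exists2 d, 0 < d & forall t x, 0 <= t < d -> `|x - x0| < d ->
    D x /\ `|F t x - x0| < e.
Proof.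
rewrite continuous_open_subspace// => fD gen Dx0 e0.
have /fD : x0 \in D by rewrite in_setE.
move=> /cvgrPdist_le/(_ 1 ltr01) f1.
have : \forall x \near x0, `|f x0 - f x| <= 1 /\ D x.
  by apply: filterI f1 _; apply: open_nbhs_nbhs.
move=> /nbhs_ballP[r0 /= r00 hr0].
pose r := Num.min r0 e.
have r_gt0 : 0 < r by rewrite lt_min r00.
have hr x : `|x - x0| < r -> D x /\ `|f x| <= `|f x0| + 1.
  rewrite lt_min distrC => /andP[xr _].
  have [|/= fx Dx] := hr0 x; first by rewrite -ball_normE.
  split => //; have := ler_normD (f x - f x0) (f x0).
  by rewrite subrK [`|f x - f x0|]distrC; lra.
(* One unit covers the variation of [f] on the ball, the other the error of the right derivative,
   taken with tolerance [1]. *)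
pose M := `|f x0| + 2.
have M0 : 2 <= M by rewrite lerDr.
exists (r / (2 * M)); first by rewrite divr_gt0//; lra.
have rM : r / (2 * M) * M = r / 2 by field; rewrite gt_eqF//; lra.
have rM2 : r / (2 * M) * 2 <= r / (2 * M) * M.
  by rewrite ler_pM2l// divr_gt0//; lra.
move=> t x /andP[t0 td] xd.
have xr : `|x - x0| < r by lra.
have [Dx _] := hr x xr; split => //.
have tM : t * M < r / 2 by rewrite -rM ltr_pM2r//; lra.
suff : `|F t x - F 0 x| <= M * (t - 0).
  rewrite subr0 semigroup0// => h.
  apply: (@lt_le_trans _ _ r); last by rewrite ge_min lexx orbT.
  have := ler_distD x (F t x) x0; lra.
apply: (norm_increment_le (u := F^~ x)) => //; first lra.
  move=> s /andP[s0 _]; apply: cvg_at_left_filter.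
  exact: semigroup_continuous_time.
move=> s /andP[s0 st]; rewrite semigroup0// subr0 => Fs.
have sM : M * s <= t * M by rewrite mulrC ler_wpM2r//; lra.
have [|_ fs] := hr (F s x); first by have := ler_distD x (F s x) x0; lra.
have /near_rightP[d d0 hd] := semigroup_right_derivative gen s0 Dx ltr01.
apply/near_rightP; exists d => // s' sd; have := hd _ sd.
have := ler_normD (F s' x - F s x - (s' - s) *: f (F s x))
  ((s' - s) *: f (F s x)).
have ss0 : 0 < s' - s by lra.
rewrite subrK normrZ (gtr0_norm ss0).
have : (s' - s) * `|f (F s x)| <= (s' - s) * (M - 1).
  by rewrite ler_pM2l//; rewrite /M; lra.
lra.
Qed.

End semigroup.

(** * Semicocycles *)

Section semicocycle.
Context (R : realType) (X : completeNormedModType R) (A : banachAlgebra R).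
Context (D : set X) (F : R -> X -> X) (f : X -> X) (G : R -> X -> A).
Hypotheses (Dopen : open D) (sgF : semigroup_on D F).
Hypotheses (fD : {within D, continuous f}) (gen : generated_by D F f).
Hypotheses (dG : forall t x, 0 <= t -> D x -> differentiable (G t) x).
Hypotheses (scG : semicocycle D F G).

Lemma semicocycle_add t s x : 0 <= t -> 0 <= s -> D x ->
  G (t + s) x = G t (F s x) * G s x.
Proof. by case: scG => GG _ t0 s0 Dx; rewrite GG. Qed.

(** As [t] tends to [0], [G t (F 0 x) * G 0 x = G t x] tends both to [G 0 x] and to [1]. *)
Lemma semicocycle0 x : D x -> G 0 x = 1.
Proof.
case: scG => GG G0 Dx; have G1 := G0 _ Dx.
apply: (@norm_cvg_unique _ _ (G t x @[t --> 0^'+])); last exact: G1.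
have : G t x * G 0 x @[t --> 0^'+] --> 1 * G 0 x.
  by apply: cvg_banach_mul => //; exact: cvg_cst.
rewrite mul1r.
apply: cvg_trans; apply: near_eq_cvg.
near=> t; have t0 : 0 <= t by near: t; exact: nbhs_right_ge.
by have := GG t 0 x t0 (lexx 0) Dx; rewrite (semigroup0 sgF Dx) addr0.
Unshelve. all: by end_near. Qed.

Lemma semicocycle_cvg t x : 0 <= t -> D x -> G t y @[y --> x] --> G t x.
Proof. by move=> t0 Dx; exact: differentiable_continuous (dG t0 Dx). Qed.

Lemma semicocycle_cvg_right (t : R) x : 0 <= t -> D x ->
  G s x @[s --> t^'+] --> G t x.
Proof.
case: scG => _ G0 t0 Dx.
have : G h (F t x) * G t x @[h --> 0^'+] --> 1 * G t x.
  apply: cvg_banach_mul; last exact: cvg_cst.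
  by apply: G0; apply: (semigroup_in sgF).
rewrite mul1r => /cvg_rightP Gh; apply/cvg_rightP => e /Gh[d d0 hd].
exists d => // h hd'; have := hd h hd'; rewrite add0r [t + h]addrC.
by rewrite semicocycle_add//; lra.
Qed.

(** Same transport as for the orbits: near a continuity point [s], write the cocycle as
    [G (t - s) (F s' x) * G s' x]. *)
Lemma semicocycle_continuous_time (t : R) x : 0 < t -> D x ->
  G s x @[s --> t] --> G t x.
Proof.
move=> t0 Dx.
have [s|s /andP[s0 st] Gs] := continuity_point (u := G^~ x) t0.
  by move=> /andP[s0 _]; exact: semicocycle_cvg_right.
have ts0 : 0 <= t - s by lra.
have : G (t - s) (F s' x) * G s' x @[s' --> s] --> G (t - s) (F s x) * G s x.
  apply: cvg_banach_mul => //.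
  apply: (cvg_comp _ _ (semigroup_continuous_time Dopen sgF s0 Dx)).
  by apply: semicocycle_cvg => //; apply: (semigroup_in sgF) => //; lra.
move=> /cvg_realP h; apply/cvg_realP => e /h[d d0 hd].
exists (Num.min d s); first by rewrite lt_min d0.
move=> t'; rewrite lt_min => /andP[td ts].
have {ts} : - s < t' - t by move: ts; rewrite ltr_norml => /andP[].
move=> ts; have := hd (t' - (t - s)).
rewrite -!semicocycle_add//; [|lra|lra].
have -> : t - s + (t' - (t - s)) = t' by lra.
rewrite subrK; apply.
by have -> : t' - (t - s) - s = t' - t by lra.
Qed.

(* Separate continuity only gives joint continuity at some [(s, x0)] with
   [s > 0]; since [G s x0] is close to [1] for small [s], the factor [G t x] of
   [G (s + t) x = G s (F t x) * G t x] can be cancelled. *)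
Lemma semicocycle_near0 x0 e : D x0 -> 0 < e ->
  exists2 d, 0 < d & forall t x, 0 <= t < d -> `|x - x0| < d ->
    `|G t x - 1| <= e.
Proof.
move=> Dx0 e0; have [_ G0] := scG.
have q0 : 0 < 4^-1 :> R by lra.
have /cvg_rightP/(_ _ q0)[eta eta0 heta] := G0 _ Dx0.
have := open_nbhs_nbhs (conj Dopen Dx0) => /nbhs_ballP[r /= r0 hr].
have [x t xr /andP[t0 _]|t /andP[t0 _]|s /andP[s0 se] hs] :=
  joint_continuity_point (g := G) (x0 := x0) r0 eta0.
- apply: semicocycle_cvg_right => //; apply: hr.
  by rewrite -ball_normE /= distrC.
- exact: semicocycle_cvg.
pose e1 := Num.min 4^-1 (e / 4).
have e10 : 0 < e1 by rewrite lt_min q0 divr_gt0.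
have [d1 d10 hd1] := hs _ e10.
have [d2 d20 hd2] := semigroup_near0 Dopen sgF fD gen Dx0 d10.
exists (Num.min d1 d2); first by rewrite lt_min d10.
move=> t x; rewrite !lt_min => /andP[t0 /andP[td1 td2]] /andP[xd1 xd2].
have [|Dx Fx] := hd2 t x _ xd2; first by rewrite t0.
set g := G t x; set p := G (s + t) x; set q := G s (F t x).
have pE : p = q * g by rewrite /p semicocycle_add// ltW.
have h1 : `|p - G s x0| <= e1.
  by apply: hd1 => //; rewrite addrC addKr ger0_norm.
have h2 : `|q - G s x0| <= e1.
  by apply: hd1 => //; rewrite subrr normr0.
have h3 : `|G s x0 - 1| <= 4^-1 by have := heta s; rewrite add0r s0 => /(_ se).
have e14 : e1 <= 4^-1 by rewrite ge_min lexx.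
have e1e : e1 <= e / 4 by rewrite ge_min lexx orbT.
have h4 : `|q - 1| <= 2^-1 by have := ler_distD (G s x0) q 1; lra.
(* Since [q - 1] has norm at most [1/2], the last product is absorbed: the norm of [g - 1] is at
   most twice that of [p - q], hence at most [4 * e1]. *)
have gE : g - 1 = (p - q) - (q - 1) * (g - 1).
  by rewrite pE mulrBl mul1r mulrBr mulr1 subKr.
have h5 : `|(q - 1) * (g - 1)| <= 2^-1 * `|g - 1|.
  by apply: le_trans (banach_normM _ _) _; rewrite ler_wpM2r.
have := ler_normB (p - q) ((q - 1) * (g - 1)); rewrite -gE.
have := ler_distD (G s x0) p q; rewrite [`|G s x0 - q|]distrC; lra.
Qed.

(** * Convergence of the difference quotients at time zero *)

Hypothesis jc : jointly_continuous D (fun t x => 'd (G t) x (f x)).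

Lemma semicocycle_increment x0 e : D x0 -> 0 < e ->
  exists2 d, 0 < d & forall t h x, 0 <= t < d -> 0 <= h < d ->
    `|x - x0| < d -> `|G t (F h x) - G t x| <= e * h.
Proof.
move=> Dx0 e0.
(* [G 0] is constantly [1] along the orbit of [x0], so its derivative in the direction [f x0]
   vanishes; joint continuity then makes the derivative small near [(0, x0)]. *)
have c0 : 'd (G 0) x0 (f x0) = 0.
  apply: (right_derivative_cst (u := G 0 \o F^~ x0) (t := 0)).
    by move=> s s0 /=; rewrite !semicocycle0//; apply: (semigroup_in sgF).
  have := semigroup_right_derivative sgF gen (lexx 0) Dx0.
  rewrite (semigroup0 sgF Dx0) => F0.
  have := @right_derivative_comp _ _ _ (G 0) (F^~ x0) 0 (f x0).
  by rewrite /= (semigroup0 sgF Dx0); apply => //; exact: dG.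
have [d1 d10 hd1] : exists2 d, 0 < d & forall t x, 0 <= t < d ->
    `|x - x0| < d -> D x -> `|'d (G t) x (f x)| <= e.
  have D0 : (`[0, +oo[%classic `*` D) (0 : R, x0).
    by split => //=; rewrite in_itv /= lexx.
  pose c t x := 'd (G t) x (f x).
  have : c p.1 p.2 @[p --> within (`[0, +oo[%classic `*` D)
      (nbhs ((0 : R), x0))] --> (0 : A).
    by rewrite -c0; exact: (subspace_continuousP _ _).1 jc _ D0.
  move=> /cvgrPdist_le/(_ _ e0)/nbhs_ballP[d /= d0 hd].
  exists d => // t x /andP[t0 td] xd Dx.
  have := hd (t, x); rewrite sub0r normrN; apply.
    split => /=; first by rewrite -ball_normE /= sub0r normrN ger0_norm.
    by rewrite -ball_normE /= distrC.
  by split => //=; rewrite in_itv /= t0.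
have [d2 d20 hd2] := semigroup_near0 Dopen sgF fD gen Dx0 d10.
exists (Num.min d1 d2); first by rewrite lt_min d10.
move=> t h x /andP[t0]; rewrite !lt_min => /andP[td1 td2].
move=> /andP[h0 /andP[hd1' hd2']] /andP[xd1 xd2].
have Dx : D x by have [] := hd2 0 x _ xd2; rewrite ?lexx.
have -> : G t (F h x) - G t x =
   (G t \o F^~ x) h - (G t \o F^~ x) 0 - (h - 0) *: 0.
  by rewrite /= scaler0 subr0 (semigroup0 sgF Dx).
rewrite -[X in _ * X]subr0.
apply: (mean_value_le (l := fun s => 'd (G t) (F s x) (f (F s x)))) => //.
- exact: ltW.
- move=> s /andP[s0 sh]; apply: cvg_at_left_filter.
  apply: (cvg_comp _ _ (semigroup_continuous_time Dopen sgF s0 Dx)).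
  by apply: semicocycle_cvg => //; apply: (semigroup_in sgF) => //; lra.
- move=> s /andP[s0 sh].
  have DF : D (F s x) by apply: (semigroup_in sgF).
  split; first by apply: right_derivative_comp;
    [exact: dG | exact: (semigroup_right_derivative sgF gen)].
  have [|_ Fx] := hd2 s x _ xd2; first by rewrite s0; lra.
  by rewrite subr0; apply: hd1 => //; rewrite t0.
Qed.

Lemma semicocycle_telescope x h e n : 0 <= h -> D x ->
  (forall k, (k < n)%N -> `|G (k%:R * h) (F h x) - 1| <= e /\
     `|G (k%:R * h) (F h x) - G (k%:R * h) x| <= e * h) ->
  `|(G (n%:R * h) x - 1) - n%:R *: (G h x - 1)| <=
  n%:R * (e * (`|G h x - 1| + h)).
Proof.
move=> h0 Dx; elim: n => [|n IH] hk.
  by rewrite !mul0r scale0r semicocycle0// !subrr normr0.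
have {IH} := IH (fun k kn => hk k (ltnW kn)).
have [h1 h2] := hk n (ltnSn n).
have nh : 0 <= n%:R * h by rewrite mulr_ge0.
rewrite -natr1 mulrDl mul1r semicocycle_add//.
set a := G (n%:R * h) x in h2 *; set b := G (n%:R * h) (F h x) in h1 h2 *.
set g := G h x.
have -> : b * g - 1 - (n%:R + 1) *: (g - 1) =
    (a - 1 - n%:R *: (g - 1)) + ((b - 1) * (g - 1) + (b - a)).
  set V := n%:R *: (g - 1); set W := g - 1.
  have -> : (b - 1) * W = b * g - b - W by rewrite mulrBl mul1r mulrBr mulr1.
  rewrite [b * g - b - W]addrAC [_ + (b - a)]addrA subrK.
  rewrite [RHS]addrC -(addrA a) addrA subrK scalerDl scale1r opprD.
  by rewrite [RHS]addrACA [- W - V]addrC.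
have h3 : `|(b - 1) * (g - 1)| <= e * `|g - 1|.
  by apply: le_trans (banach_normM _ _) _; rewrite ler_wpM2r.
have := ler_normD (a - 1 - n%:R *: (g - 1)) ((b - 1) * (g - 1) + (b - a)).
have := ler_normD ((b - 1) * (g - 1)) (b - a).
lra.
Qed.

Definition semicocycle_quotient (h : R) (x : X) : A := h^-1 *: (G h x - 1).
Local Notation Dq := semicocycle_quotient.

(** For fixed [tau] and small [h], a multiple [n * h] close to [tau] links [Dq tau] to [Dq h]: right
    continuity in time handles the first gap, telescoping the second. The radius [d] is the same for
    all [x] near [x0]. *)
Lemma semicocycle_quotient_near x0 (e : R) : D x0 -> 0 < e ->
  exists2 d, 0 < d & forall tau x, 0 < tau < d -> `|x - x0| < d -> D x /\
    \forall h \near 0^'+, `|Dq tau x - Dq h x| <= e * `|Dq h x| + e.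
Proof.
move=> Dx0 e0; pose e1 := e / 2; have e10 : 0 < e1 by rewrite divr_gt0.
have [d1 d10 hd1] := semicocycle_near0 Dx0 e10.
have [d2 d20 hd2] := semicocycle_increment Dx0 e10.
have [d3 d30 hd3] := semigroup_near0 Dopen sgF fD gen Dx0 d10.
exists (Num.min d1 (Num.min d2 d3)); first by rewrite !lt_min d10 d20.
move=> tau x; rewrite !lt_min => /andP[t0 /andP[td1 /andP[td2 td3]]].
move=> /andP[xd1 /andP[xd2 xd3]].
have Dx : D x by have [] := hd3 0 x _ xd3; rewrite ?lexx.
split => //.
have : Dq s x @[s --> tau^'+] --> Dq tau x.
  apply: cvgZ.
    apply: cvg_at_right_filter.
    by apply: cvgV; rewrite ?gt_eqF//; exact: cvg_id.
  apply: cvgB; last exact: cvg_cst.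
  by apply: semicocycle_cvg_right => //; exact: ltW.
move=> /cvg_rightP/(_ _ e10)[d4 d40 hd4].
apply/near_rightP.
exists (Num.min d4 (Num.min (d1 - tau) (Num.min (d2 - tau) (d3 - tau)))).
  by rewrite !lt_min !subr_gt0 d40 td1 td2.
move=> h; rewrite add0r !lt_min => /andP[h0 /andP[hd4' /andP[h1 /andP[h2 h3]]]].
(* One more than the integer part, so that [n * h] lies in []tau, tau + h]] and approaches [tau]
   from the right, while [k * h <= tau] for every [k < n]. *)
pose n := (Num.truncn (tau / h)).+1.
have nh1 : tau < n%:R * h by rewrite -ltr_pdivrMr// truncnS_gt.
have nh2 : n%:R * h <= tau + h.
  rewrite /n -natr1 mulrDl mul1r lerD2r -ler_pdivlMr//.
  by rewrite truncn_le divr_ge0// ltW.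
have n0 : 0 < n%:R :> R by rewrite ltr0Sn.
have Dqn : `|Dq tau x - Dq (n%:R * h) x| <= e1.
  have := hd4 (n%:R * h - tau).
  by rewrite [tau + _]addrC subrK distrC; apply; lra.
have T : `|(G (n%:R * h) x - 1) - n%:R *: (G h x - 1)| <=
    n%:R * (e1 * (`|G h x - 1| + h)).
  apply: (semicocycle_telescope (ltW h0) Dx) => k kn.
  have kh0 : 0 <= k%:R * h by rewrite mulr_ge0// ltW.
  have kh : k%:R * h <= tau.
    have : k%:R + 1 <= n%:R :> R by rewrite natr1 ler_nat.
    by move=> /(ler_wpM2r (ltW h0)); rewrite mulrDl mul1r; lra.
  split; last by apply: hd2 => //; [rewrite kh0/=; lra | rewrite ltW//=; lra].
  apply: hd1; first by rewrite kh0/=; lra.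
  by have [|//] := hd3 h x _ xd3; rewrite ltW//=; lra.
have n0h : n%:R != 0 :> R by rewrite gt_eqF.
have h0h : h != 0 by rewrite gt_eqF.
have Dqnh : `|Dq (n%:R * h) x - Dq h x| <= e1 * (`|Dq h x| + 1).
  have -> : Dq (n%:R * h) x - Dq h x =
      (n%:R * h)^-1 *: ((G (n%:R * h) x - 1) - n%:R *: (G h x - 1)).
    rewrite /Dq [RHS]scalerBr scalerA; congr (_ - _ *: _).
    by field; rewrite h0h n0h.
  have nh0 : 0 < (n%:R * h)^-1 by rewrite invr_gt0 mulr_gt0.
  rewrite normrZ gtr0_norm//.
  apply: le_trans (ler_wpM2l (ltW nh0) T) _.
  rewrite /Dq normrZ gtr0_norm ?invr_gt0// le_eqVlt; apply/orP; left; apply/eqP.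
  by field; rewrite h0h n0h.
have := ler_distD (Dq (n%:R * h) x) (Dq tau x) (Dq h x).
have := normr_ge0 (Dq h x); rewrite /e1 in Dqnh Dqn; nra.
Qed.

Lemma semicocycle_quotient_cvg x : D x ->
  exists l : A, Dq h x @[h --> 0^'+] --> l.
Proof.
move=> Dx; suff : cvg (Dq h x @[h --> 0^'+]) by move=> /cvg_ex.
(* With the factor [1/2] the term in [Dq h x] is absorbed, which bounds it by [M = 2 * N + 1]. *)
have e0 : 0 < 2^-1 :> R by lra.
have [d d0 hd] := semicocycle_quotient_near Dx e0.
have x0 : forall e : R, 0 < e -> `|x - x| < e by move=> e; rewrite subrr normr0.
have /hd/(_ (x0 _ d0))[_] : 0 < d / 2 < d by lra.
set N := `|Dq (d / 2) x| => near1.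
pose M := 2 * N + 1.
have nearM : \forall h \near 0^'+, `|Dq h x| <= M.
  apply: filterS near1 => h.
  have := ler_distD (Dq (d / 2) x) (Dq h x) 0.
  rewrite !subr0 [`|Dq h x - _|]distrC -/N /M; lra.
have M0 : 0 < M + 2 by have := normr_ge0 (Dq (d / 2) x); rewrite -/N /M; lra.
apply: cauchy_cvg; apply: cauchy_exP => e /= e_gt0.
(* The error is then at most [e / (M + 2) * (M + 1)]; using [M + 2] makes this strictly less than
   [e], as the open ball requires. *)
have e1 : 0 < e / (M + 2) by rewrite divr_gt0.
have [d1 d10 hd1] := semicocycle_quotient_near Dx e1.
have /hd1/(_ (x0 _ d10))[_ near2] : 0 < d1 / 2 < d1 by lra.
exists (Dq (d1 / 2) x); rewrite -ball_normE.
apply: filterS2 nearM near2 => h hM /= /le_lt_trans; apply.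
have h1 : e / (M + 2) * `|Dq h x| <= e / (M + 2) * M by rewrite ler_pM2l.
have h2 : e / (M + 2) * (M + 2) = e by rewrite divfK// gt_eqF.
lra.
Qed.

(** * Continuity of the generator and the right derivative of the semicocycle *)

Variable B : X -> A.
Hypothesis DqB : forall x, D x -> Dq h x @[h --> 0^'+] --> B x.

(** Let [h] tend to [0] in [semicocycle_quotient_near] with [tau] fixed; the slack [r] pays for
    stopping at a finite [h]. *)
Lemma semicocycle_quotient_uniform x0 (e : R) : D x0 -> 0 < e ->
  exists2 d, 0 < d & forall tau x, 0 < tau < d -> `|x - x0| < d ->
    `|Dq tau x - B x| <= e * `|B x| + e.
Proof.
move=> Dx0 e0; have [d d0 hd] := semicocycle_quotient_near Dx0 e0.
exists d => // tau x td xd; have [Dx near1] := hd _ _ td xd.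
apply/ler_addgt0Pr => r r0.
have r1 : 0 < r / (1 + e) by rewrite divr_gt0//; lra.
have /cvgrPdist_le/(_ _ r1) near2 := DqB Dx.
near (0 : R)^'+ => h.
have h1 : `|Dq tau x - Dq h x| <= e * `|Dq h x| + e by near: h.
have h2 : `|B x - Dq h x| <= r / (1 + e) by near: h.
have h3 := ler_distD (Dq h x) (Dq tau x) (B x).
have h4 : e * `|Dq h x| <= e * (`|B x| + r / (1 + e)).
  rewrite ler_pM2l//; have := ler_distD (B x) (Dq h x) 0.
  rewrite !subr0 [`|Dq h x - B x|]distrC; lra.
have rE : r = r / (1 + e) + e * (r / (1 + e)) by field; rewrite gt_eqF//; lra.
rewrite distrC in h2; lra.
Unshelve. all: by end_near. Qed.

Lemma semicocycle_generator_continuous : {within D, continuous B}.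
Proof.
rewrite continuous_open_subspace// => x0; rewrite in_setE => Dx0.
apply/cvgrPdist_le => r r0.
have b0 := normr_ge0 (B x0).
(* The estimate is relative to the norm of [B x], which is bounded by that of [B x0] plus that of
   [B x0 - B x]. The bound [1/2] absorbs the latter; the other bound makes the remaining errors at
   most [r / 8] each. *)
pose e := Num.min 2^-1 (r / (8 * (`|B x0| + 1))).
have e0 : 0 < e.
  by rewrite lt_min; apply/andP; split; [lra | rewrite divr_gt0//; lra].
have e2 : e <= 2^-1 by rewrite ge_min lexx.
have er : e * (`|B x0| + 1) <= r / 8.
  have -> : r / 8 = r / (8 * (`|B x0| + 1)) * (`|B x0| + 1).
    by field; rewrite gt_eqF//; lra.
  by rewrite ler_wpM2r ?ge_min ?lexx ?orbT//; lra.
have [d d0 hd] := semicocycle_quotient_uniform Dx0 e0.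
have td : 0 < d / 2 < d by lra.
have r8 : 0 < r / 8 by lra.
have Dqc : Dq (d / 2) x @[x --> x0] --> Dq (d / 2) x0.
  apply: cvgZr; apply: cvgB; last exact: cvg_cst.
  by apply: semicocycle_cvg => //; lra.
near=> x.
have h1 : `|Dq (d / 2) x0 - Dq (d / 2) x| <= r / 8.
  by near: x; move/cvgrPdist_le : Dqc; apply.
have xd : `|x - x0| < d.
  near: x; apply/nbhs_ballP; exists d => //= y.
  by rewrite -ball_normE /= distrC.
have := hd _ _ td xd.
have := hd _ x0 td; rewrite subrr normr0 => /(_ d0) h2 h3.
have h4 := ler_distD (Dq (d / 2) x0) (B x0) (B x).
have h5 := ler_distD (Dq (d / 2) x) (Dq (d / 2) x0) (B x).
have h6 : e * `|B x| <= e * (`|B x0| + `|B x0 - B x|).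
  rewrite ler_pM2l//; have := ler_distD (B x0) (B x) 0.
  by rewrite !subr0 [`|B x - B x0|]distrC; lra.
have h7 : e * `|B x0 - B x| <= 2^-1 * `|B x0 - B x| by rewrite ler_wpM2r.
rewrite distrC in h2; lra.
Unshelve. all: by end_near. Qed.

(** By the cocycle law, the difference quotient at [t] with increment [h] is exactly
    [Dq h (F t x) * G t x]. *)
Lemma semicocycle_right_derivative (t : R) x : 0 <= t -> D x ->
  right_derivative (G^~ x) t (B (F t x) * G t x).
Proof.
move=> t0 Dx; apply/right_derivativeP.
have : Dq h (F t x) * G t x @[h --> 0^'+] --> B (F t x) * G t x.
  apply: cvg_banach_mul; last exact: cvg_cst.
  by apply: DqB; apply: (semigroup_in sgF).
apply: cvg_trans; apply: near_eq_cvg.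
near=> h; have h0 : 0 <= h by near: h; exact: nbhs_right_ge.
rewrite /Dq -scalerAl mulrBl mul1r [t + h]addrC; congr (_ *: (_ - _)).
by rewrite semicocycle_add.
Unshelve. all: by end_near. Qed.
End semicocycle.

(** * Differentiability on the half-line *)

Lemma cvg_within_ge0 (R : realType) (Y : normedModType R) (u : R -> Y) :
  (forall t : R, 0 <= t -> u s @[s --> t^'+] --> u t) ->
  (forall t : R, 0 < t -> u s @[s --> t] --> u t) ->
  forall t : R, 0 <= t ->
    u s @[s --> within `[0, +oo[%classic (nbhs t)] --> u t.
Proof.
move=> ur ut t; rewrite le_eqVlt => /predU1P[<-|t0]; last first.
  exact: cvg_within_filter (ut _ t0).
apply/cvgrPdist_le => e e0.
have /cvgrPdist_le/(_ _ e0)/near_rightP[d d0 hd] := ur _ (lexx 0).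
apply/nbhs_ballP; exists d => //= s; rewrite /ball/= in_itv/= andbT => sd.
rewrite le_eqVlt => /predU1P[<-|s0]; first by rewrite subrr normr0 ltW.
by apply: hd; rewrite s0 add0r; move: sd; rewrite sub0r normrN gtr0_norm.
Qed.

Lemma cvg_diff_quotientP (R : realType) (Y : normedModType R) (v : R -> Y)
    (t : R) (l : Y) :
  diff_quotient v t s @[s --> within `[0, +oo[%classic t^'] --> l <->
  forall e, 0 < e -> exists2 d, 0 < d & forall s, 0 <= s -> `|s - t| < d ->
    `|v s - v t - (s - t) *: l| <= e * `|s - t|.
Proof.
have H s : s != t -> v s - v t - (s - t) *: l =
    (s - t) *: (diff_quotient v t s - l).
  move=> st; rewrite /diff_quotient [RHS]scalerBr scalerA divff ?subr_eq0//.
  by rewrite scale1r.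
split=> [/cvgrPdist_le vl e e0|vl].
  have /nbhs_ballP[d /= d0 hd] := vl _ e0; exists d => // s s0 sd.
  have [->|st] := eqVneq s t.
    by rewrite !subrr scale0r subr0 !normr0 mulr0.
  rewrite H// normrZ mulrC ler_wpM2r// distrC.
  by apply: hd => //; rewrite /ball/= 1?distrC// in_itv/= s0.
apply/cvgrPdist_le => e /vl[d d0 hd]; apply/nbhs_ballP; exists d => //= s.
rewrite /ball/= distrC => sd st; rewrite in_itv/= andbT => s0.
have := hd s s0 sd; rewrite H// normrZ mulrC ler_pM2r ?normr_gt0 ?subr_eq0//.
by rewrite distrC.
Qed.

Lemma within_ge0_dnbhs_proper (R : realType) (t : R) : 0 <= t ->
  ProperFilter (within `[0, +oo[%classic t^').
Proof.
move=> t0; apply: Build_ProperFilter_ex => P /nbhs_ballP[d /= d0 hd].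
have td : t - (t + d / 2) = - (d / 2) by lra.
exists (t + d / 2); apply: hd; rewrite /ball/= ?in_itv/= ?andbT.
- by rewrite td normrN gtr0_norm; lra.
- by rewrite eq_sym -subr_eq0 td oppr_eq0 gt_eqF//; lra.
- lra.
Qed.

Lemma diff_quotient_cvg_derive (R : realType) (Y : normedModType R)
    (v : R -> Y) (t : R) (l : Y) : 0 <= t ->
  diff_quotient v t s @[s --> within `[0, +oo[%classic t^'] --> l ->
  derivable_ge0 v t /\ derive_ge0 v t = l.
Proof.
move=> /within_ge0_dnbhs_proper FF vl; split; first by apply/cvg_ex; exists l.
exact: cvg_lim.
Qed.

Lemma diff_quotient_right0 (R : realType) (Y : normedModType R) (v : R -> Y)
    (l : Y) :
  right_derivative v 0 l ->
  diff_quotient v 0 s @[s --> within `[0, +oo[%classic (0 : R)^'] --> l.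
Proof.
move=> vl; apply/cvg_diff_quotientP => e /vl/near_rightP[d d0 hd].
exists d => // s; rewrite subr0 le_eqVlt => /predU1P[<-|s0].
  by rewrite subrr scale0r subr0 !normr0 mulr0.
by rewrite gtr0_norm// => sd; have := hd s; rewrite subr0 add0r s0; apply.
Qed.

(* By the mean value inequality, a continuous function with a continuous right
   derivative is differentiable. *)
Lemma diff_quotient_cvg (R : realType) (Y : normedModType R) (v b : R -> Y) :
  (forall t : R, 0 < t -> v s @[s --> t] --> v t) ->
  (forall t : R, 0 <= t -> right_derivative v t (b t)) ->
  forall t : R, 0 <= t ->
    b s @[s --> within `[0, +oo[%classic (nbhs t)] --> b t ->
    diff_quotient v t s @[s --> within `[0, +oo[%classic t^'] --> b t.
Proof.
move=> vc vb t t0 bt; apply/cvg_diff_quotientP => e e0.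
move/cvgrPdist_le : bt => /(_ _ e0)/nbhs_ballP[d /= d0 hd].
have hb s : 0 <= s -> `|s - t| < d -> `|b s - b t| <= e.
  move=> s0 sd; rewrite distrC; apply: hd; rewrite /ball/= 1?distrC//.
  by rewrite in_itv/= s0.
exists d => // s s0 sd.
(* Stated for an ordered pair so that it serves both [t <= s] and [s < t]: right derivatives control
   increments on either side of [t]. *)
have mv p q : 0 <= p -> p <= q -> `|p - t| < d -> `|q - t| < d ->
    `|v q - v p - (q - p) *: b t| <= e * (q - p).
  move=> p0 pq pd qd; apply: (mean_value_le (l := b)) => //; first exact: ltW.
    by move=> r /andP[pr _]; apply: cvg_at_left_filter; apply: vc; lra.
  move=> r /andP[pr rq]; split; first by apply: vb; lra.
  apply: hb; first lra.
  move: pd qd; rewrite !ltr_norml => /andP[? _] /andP[_ ?].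
  by apply/andP; split; lra.
have tt : `|t - t| < d by rewrite subrr normr0.
have [ts|st] := leP t s.
  by rewrite (ger0_norm (_ : 0 <= s - t)) ?subr_ge0//; exact: mv.
rewrite [`|s - t|]distrC (gtr0_norm (_ : 0 < t - s)) ?subr_gt0//.
have -> : v s - v t - (s - t) *: b t = - (v t - v s - (t - s) *: b t).
  by rewrite -(opprB t s) scaleNr opprK [RHS]opprB (opprB (v t)) addrC.
by rewrite normrN; apply: mv => //; exact: ltW.
Qed.

(** * Uniqueness for the linear evolution equation *)

Lemma diff_quotient_right_derivative (R : realType) (Y : normedModType R)
    (v : R -> Y) (t : R) (l : Y) : 0 <= t ->
  diff_quotient v t s @[s --> within `[0, +oo[%classic t^'] --> l ->
  right_derivative v t l.
Proof.
move=> t0 /cvg_diff_quotientP vl e /vl[d d0 hd].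
apply/near_rightP; exists d => // s std.
have st : 0 < s - t by lra.
have := hd s; rewrite (gtr0_norm st); apply; lra.
Qed.

Lemma diff_quotient_continuous (R : realType) (Y : normedModType R)
    (v : R -> Y) (t : R) (l : Y) : 0 < t ->
  diff_quotient v t s @[s --> within `[0, +oo[%classic t^'] --> l ->
  v s @[s --> t] --> v t.
Proof.
move=> t0 /cvg_diff_quotientP/(_ _ ltr01)[d d0 hd].
apply/cvg_realP => e e0; have l0 := normr_ge0 l.
have l1 : 0 < 1 + `|l| by lra.
exists (Num.min t (Num.min d (e / (1 + `|l|)))).
  by rewrite !lt_min t0 d0 divr_gt0.
move=> s; rewrite !lt_min => /andP[st /andP[sd]].
rewrite ltr_pdivlMr// => se.
have s0 : 0 <= s by move: st; rewrite ltr_norml => /andP[? _]; lra.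
have := hd _ s0 sd.
have := ler_normD (v s - v t - (s - t) *: l) ((s - t) *: l).
rewrite subrK normrZ; lra.
Qed.

(** On [[0, T]] the continuous coefficient [b] has bounded norm by compactness, and the difference
    of two solutions solves the same linear equation from [0], so Gronwall's lemma applies. *)
Lemma evolution_solution_unique (R : realType) (A : banachAlgebra R)
    (b v w : R -> A) :
  (forall t : R, 0 <= t ->
     b s @[s --> within `[0, +oo[%classic (nbhs t)] --> b t) ->
  evolution_solution b v -> evolution_solution b w ->
  forall t : R, 0 <= t -> v t = w t.
Proof.
move=> bc [hv v0] [hw w0] T T0.
have der (u : R -> A) : (forall t : R, 0 <= t ->
      derivable_ge0 u t /\ derive_ge0 u t = b t * u t) ->
    forall t : R, 0 <= t ->
    diff_quotient u t s @[s --> within `[0, +oo[%classic t^'] --> b t * u t.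
  by move=> hu t t0; have [ud <-] := hu t t0.
have dv := der _ hv; have dw := der _ hw.
have [M M0 hM] : exists2 M, 0 <= M & forall t : R, 0 <= t <= T -> `|b t| <= M.
  have [|c cT hc] := @EVT_max R (fun t => `|b t|) 0 T T0.
    apply/subspace_continuousP => t; rewrite /= in_itv/= => /andP[t0 tT].
    apply: cvg_norm; have := bc t t0; apply: cvg_trans.
    apply: cvg_app; apply: within_subset => s /=.
    by rewrite !in_itv/= => /andP[->].
  by exists `|b c| => // t tT; apply: hc; rewrite in_itv.
apply/eqP; rewrite -subr_eq0; apply/eqP.
apply: (@gronwall_eq0 R A (v \- w) (fun t => b t * (v t - w t)) 0 T M) => //=.
- by rewrite v0 w0 subrr.
- move=> t /andP[t0 tT]; apply: cvg_at_left_filter; apply: cvgB.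
    exact: diff_quotient_continuous t0 (dv _ (ltW t0)).
  exact: diff_quotient_continuous t0 (dw _ (ltW t0)).
- move=> t /andP[t0 tT]; split; last first.
    apply: le_trans (banach_normM _ _) _; rewrite ler_wpM2r//.
    by apply: hM; rewrite t0 ltW.
  apply: (diff_quotient_right_derivative t0).
  rewrite mulrBr; apply: cvg_trans (cvgB (dv _ t0) (dw _ t0)).
  apply: near_eq_cvg; apply: nearW => s.
  rewrite /diff_quotient !fctE /= -scalerBr; congr (_ *: _).
  by rewrite opprD opprK addrACA opprD opprK.
Qed.

Unset Implicit Arguments.

Theorem theorem4p3 (R : realType) (X : banachSpace R) (A : banachAlgebra R[i])
    (D : set X) (F : R -> X -> X) (f : X -> X)
    (Gamma : R -> X -> realification_algebra A) :
  domain D ->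
  semigroup_on D F ->
  {within D, continuous f} ->
  generated_by D F f ->
  (forall t, 0 <= t -> C1 D (Gamma t)) ->
  semicocycle D F Gamma ->
  jointly_continuous D (fun t x => 'd (Gamma t) x (f x)) ->
  (forall x, D x -> forall t, 0 <= t -> derivable_ge0 (Gamma^~ x) t) /\
  let B := fun x => derive_ge0 (Gamma^~ x) 0 in
  {within D, continuous B} /\
  (forall x, D x ->
     evolution_solution (fun t => B (F t x)) (Gamma^~ x) /\
     (forall v : R -> realification_algebra A,
        evolution_solution (fun t => B (F t x)) v ->
        forall t, 0 <= t -> v t = Gamma t x)).
Proof.
move=> [Dopen _] sgF fD gen C1G scG jc.
have dG t x : 0 <= t -> D x -> differentiable (Gamma t) x.
  by move=> t0; have [+ _] := C1G t t0; apply.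
have quotP x (l : realification_algebra A) : D x ->
    semicocycle_quotient Gamma h x @[h --> 0^'+] --> l ->
    diff_quotient (Gamma^~ x) 0 s
      @[s --> within `[0, +oo[%classic (0 : R)^'] --> l.
  move=> Dx ql; apply: (diff_quotient_right0 (Y := realification_algebra A)).
  apply/right_derivativeP.
  move: ql; apply: cvg_trans; apply: near_eq_cvg; apply: nearW => h.
  by rewrite /semicocycle_quotient add0r (semicocycle0 sgF scG Dx).
pose B x := derive_ge0 (Gamma^~ x) 0.
(* [B x] is defined through [lim], which is informative only once convergence is known; the limit
   obtained from the Cauchy argument identifies it. *)
have DqB x : D x -> semicocycle_quotient Gamma h x @[h --> 0^'+] --> B x.
  move=> Dx.
  have [l ql] := semicocycle_quotient_cvg Dopen sgF fD gen dG scG jc Dx.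
  have [_ Bl] := diff_quotient_cvg_derive (lexx 0) (quotP x l Dx ql).
  by have -> : B x = l by exact: Bl.
have Bc := semicocycle_generator_continuous Dopen sgF fD gen dG scG jc DqB.
have BFc x : D x -> forall t : R, 0 <= t ->
    B (F s x) @[s --> within `[0, +oo[%classic (nbhs t)] --> B (F t x).
  move=> Dx t t0.
  have Ft : D (F t x) by apply: (semigroup_in sgF).
  apply: (@cvg_comp _ _ _ (F^~ x) B _ (nbhs (F t x))).
    apply: (cvg_within_ge0 (u := F^~ x)) t0 => r r0.
      exact: (semigroup_cvg_right sgF).
    exact: (semigroup_continuous_time Dopen sgF).
  move: Bc; rewrite continuous_open_subspace// => /(_ (F t x)).
  by rewrite in_setE; apply.
(* The right derivative [B (F t x) * Gamma t x] is continuous in [t] on the half-line, which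
   upgrades it to a two-sided derivative for [t > 0]. *)
have dGt x t : D x -> 0 <= t ->
    diff_quotient (Gamma^~ x) t s @[s --> within `[0, +oo[%classic t^'] -->
    B (F t x) * Gamma t x.
  move=> Dx t0.
  apply: (diff_quotient_cvg (b := fun s => B (F s x) * Gamma s x)) => //.
  - by move=> s s0; exact: (semicocycle_continuous_time Dopen sgF dG scG).
  - by move=> s s0; exact: (semicocycle_right_derivative sgF scG DqB).
  apply: cvg_banach_mul; first exact: BFc.
  apply: (cvg_within_ge0 (u := Gamma^~ x)) t0 => r r0.
    exact: (semicocycle_cvg_right sgF scG).
  exact: (semicocycle_continuous_time Dopen sgF dG scG).
have sol x : D x -> evolution_solution (fun t => B (F t x)) (Gamma^~ x).
  move=> Dx; split; last exact: (semicocycle0 sgF scG).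
  by move=> t t0; apply: diff_quotient_cvg_derive => //; exact: dGt.
split; first by move=> x Dx t t0; have [] := (sol x Dx).1 t t0.
split => // x Dx; split; first exact: sol.
move=> v hv t t0.
by apply: (evolution_solution_unique (BFc x Dx) hv (sol x Dx)).
Qed.
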